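(* Let $\sigma$ be a pure unary implicit signature containing $\kappa$, let $X$ be a finite alphabet and let $L\subseteq X^+$ be a rational language. Then, with closures taken in $\Omega^\sigma_X\mathsf S$, $\overline{L^+}=\langle\overline L\rangle_\sigma$, the $\sigma$-subalgebra of $\Omega^\sigma_X\mathsf S$ generated by $\overline L$.
   Context: $\mathsf S$ is the pseudovariety of all finite semigroups; $\overline{\Omega}_X\mathsf S$ is the free profinite semigroup on $X$ (containing $X^+$), and $\Omega^\sigma_X\mathsf S$ is its subalgebra generated by $X$ under the operations of $\sigma$, with the induced topology. $\widehat{\mathbb N}$ is the profinite completion of $(\mathbb N,+)$. A unary implicit signature consists of multiplication together with at least one unary operation $x\mapsto x^\alpha$ with $\alpha\in\widehat{\mathbb N}\setminus\mathbb N$; such $\alpha$ are its exponents. $\kappa$ consists of multiplication and the $(\omega-1)$-power. The completion $\bar\sigma$ is the smallest unary signature containing $\sigma$ whose exponent set is stable under $\alpha\mapsto\alpha-1$ and $\alpha\mapsto\alpha+1$. $\sigma$ is pure if for every positive integer $d$ and $\alpha\in\widehat{\mathbb N}$, whenever $d\alpha$ is a $\bar\sigma$-exponent, so is $\alpha$. *)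

(* Defs.v *)
From mathcomp Require Import all_boot.
Set Implicit Arguments. Unset Strict Implicit. Unset Printing Implicit Defensive.

(** * Finite semigroups, represented up to isomorphism on carriers 'I_n. *)
Record finSG := FinSG {
  fsg_card : nat;
  fsg_mul : 'I_fsg_card -> 'I_fsg_card -> 'I_fsg_card;
  fsg_assoc : associative fsg_mul }.

Definition elt (S : finSG) : Type := 'I_(fsg_card S).

Definition is_hom (S T : finSG) (h : elt S -> elt T) : Prop :=
  forall a b, h (fsg_mul a b) = fsg_mul (h a) (h b).

(** x^(k+1) in a finite semigroup *)
Definition spow (S : finSG) (x : elt S) (k : nat) : elt S :=
  iter k (fun y => fsg_mul y x) x.

(** * Implicit operations: the free profinite semigroup over X.
    An element of the free profinite semigroup on X is (identified with) an
    X-ary implicit operation: a family w S phi in S, for each finite semigroup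
    S and valuation phi : X -> S, natural w.r.t. homomorphisms. *)
Definition rawop (X : Type) := forall S : finSG, (X -> elt S) -> elt S.

Definition natural (X : Type) (w : rawop X) : Prop :=
  forall (S T : finSG) (h : elt S -> elt T), is_hom h ->
    forall phi : X -> elt S, h (w S phi) = w T (fun x => h (phi x)).

Definition letter (X : Type) (x : X) : rawop X := fun S phi => phi x.

Definition mulop (X : Type) (u v : rawop X) : rawop X :=
  fun S phi => fsg_mul (u S phi) (v S phi).

Definition word_op (X : Type) (x : X) (t : seq X) : rawop X :=
  foldl (@mulop X) (letter x) (map (@letter X) t).

(** * The profinite completion of (N,+), N = positive integers:
    NHat = unary implicit operations (free profinite monogenic semigroup).
    alpha + beta corresponds to pointwise product. *)
Definition NHat := rawop unit.

Definition finiteN (a : NHat) : Prop :=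
  exists k, forall S phi, a S phi = spow (phi tt) k.

Definition succN (a : NHat) : NHat := fun S phi => fsg_mul (a S phi) (phi tt).

(** d * alpha = alpha + ... + alpha (d >= 1 times) *)
Definition dmulN (d : nat) (a : NHat) : NHat := fun S phi => spow (a S phi) d.-1.

(** omega - 1: in a semigroup of size n, x^(omega-1) = x^(2 n! - 1) *)
Definition omega_m1 : NHat :=
  fun S phi => spow (phi tt) (2 * (fsg_card S)`! - 2).

Definition powop (X : Type) (a : NHat) (u : rawop X) : rawop X :=
  fun S phi => a S (fun _ => u S phi).

(** * Unary implicit signatures, given by their set E of exponents *)
Definition unary_signature (E : NHat -> Prop) : Prop :=
  (exists a, E a) /\ (forall a, E a -> natural a /\ ~ finiteN a).

Definition contains_kappa (E : NHat -> Prop) : Prop := E omega_m1.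

(** exponents of the completion sigma-bar: smallest set containing E and
    stable under alpha |-> alpha + 1 and alpha |-> alpha - 1 (for alpha in
    NHat \ N, alpha - 1 is the unique beta in NHat \ N with beta + 1 = alpha) *)
Inductive bar_exp (E : NHat -> Prop) : NHat -> Prop :=
| bar_base a : E a -> bar_exp E a
| bar_succ a : bar_exp E a -> bar_exp E (succN a)
| bar_pred a b : bar_exp E a -> natural b -> ~ finiteN b -> succN b = a ->
    bar_exp E b.

Definition pure (E : NHat -> Prop) : Prop :=
  forall (d : nat) (a : NHat), 0 < d -> natural a ->
    bar_exp E (dmulN d a) -> bar_exp E a.

Inductive omega_sigma (X : Type) (E : NHat -> Prop) : rawop X -> Prop :=
| os_letter x : omega_sigma E (letter x)
| os_mul u v : omega_sigma E u -> omega_sigma E v -> omega_sigma E (mulop u v)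
| os_pow a u : E a -> omega_sigma E u -> omega_sigma E (powop a u).

Fixpoint lIn (T : Type) (t : T) (l : list T) : Prop :=
  match l with nil => False | cons y l' => y = t \/ lIn t l' end.

(** closure of A in Omega^sigma_X S (profinite topology, induced):
    every basic neighbourhood (finitely many finite semigroups and valuations)
    of w meets A *)
Definition closure_in (X : Type) (E : NHat -> Prop) (A : rawop X -> Prop)
  (w : rawop X) : Prop :=
  omega_sigma E w /\
  forall ts : list {S : finSG & X -> elt S},
    exists a, A a /\
      forall t, lIn t ts -> a (projT1 t) (projT2 t) = w (projT1 t) (projT2 t).

Inductive gen_sub (X : Type) (E : NHat -> Prop) (A : rawop X -> Prop)
  : rawop X -> Prop :=
| gs_base u : A u -> gen_sub E A u
| gs_mul u v : gen_sub E A u -> gen_sub E A v -> gen_sub E A (mulop u v)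
| gs_pow a u : E a -> gen_sub E A u -> gen_sub E A (powop a u).

Inductive plus_of (X : Type) (L : seq X -> Prop) : seq X -> Prop :=
| plus_base w : L w -> plus_of L w
| plus_step u v : L u -> plus_of L v -> plus_of L (u ++ v).

Inductive rexp (X : Type) :=
| REmpty | RSym of X | RUnion of rexp X & rexp X | RCat of rexp X & rexp X
| RPlus of rexp X.
Arguments REmpty {X}.

Fixpoint rlang (X : Type) (e : rexp X) : seq X -> Prop :=
  match e with
  | REmpty => fun _ => False
  | RSym x => fun w => w = [:: x]
  | RUnion e1 e2 => fun w => rlang e1 w \/ rlang e2 w
  | RCat e1 e2 => fun w => exists u v, w = u ++ v /\ rlang e1 u /\ rlang e2 v
  | RPlus e1 => plus_of (rlang e1)
  end.

Definition rational (X : Type) (L : seq X -> Prop) : Prop :=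
  exists e : rexp X, forall w, L w <-> rlang e w.

Definition lang_image (X : Type) (L : seq X -> Prop) : rawop X -> Prop :=
  fun u => exists x t, L (x :: t) /\ u = word_op x t.

(* Main.v *)
(** Let [B] be an automaton for [L] with state set [Q]; letting it reset from a
    final state to an initial one gives an automaton for [L^+] on the same
    states. A sigma-operation [u] labels a path [p -> q] when the pair belongs to
    its value in the finite semigroup of relations on [Q]; since sigma-operations
    are limits of words, an [u] labelling a path of [B] from an initial to a final
    state lies in the closure of [L].  By induction on sigma-terms, every [u]
    labelling a path of the automaton for [L^+] either labels a path of [B] or
    factors as [a m b], with [a], [b] labelling the unfinished first and last
    factors and [m] in the subalgebra generated by the closure of [L].
    The key case is a power [v^alpha]: it labels a long walk of [v]-steps in [Q],
    which contains a cycle of length [c <= #|Q|], and the length of the walk can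
    be taken congruent to [alpha] modulo [c].  Hence
    [v^alpha = v^k1 (v^c)^beta v^k2] with [c beta = alpha - k1 - k2], where
    purity makes [beta] an exponent of the completed signature. *)
Require Import Defs.
From mathcomp Require Import all_boot zify.
From Stdlib Require Import FunctionalExtensionality.

Set Implicit Arguments.
Unset Strict Implicit.
Unset Printing Implicit Defensive.

Lemma rawop_ext (X : Type) (u v : rawop X) : (forall S phi, u S phi = v S phi) -> u = v.
Proof.
by move=> uv; apply: functional_extensionality_dep => S;
  apply: functional_extensionality_dep => phi.
Qed.

Lemma mulopA (X : Type) (u v w : rawop X) : mulop u (mulop v w) = mulop (mulop u v) w.
Proof. by apply: rawop_ext => S phi; rewrite /mulop fsg_assoc. Qed.

Lemma dvdn_fact_leq m n : m <= n -> m`! %| n`!.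
Proof. by move=> /fact_split ->; apply: dvdn_mulr. Qed.

(** * Powers in finite semigroups and their eventual periodicity *)

Section Powers.
Variable S : finSG.
Implicit Types x y : elt S.

Lemma spowS x k : spow x k.+1 = fsg_mul (spow x k) x.
Proof. by []. Qed.

Lemma spowD x i j : fsg_mul (spow x i) (spow x j) = spow x (i + j).+1.
Proof.
elim: j => [|j IH]; first by rewrite addn0 spowS.
by rewrite spowS fsg_assoc IH addnS.
Qed.

Lemma spow_spow x i j : spow (spow x i) j = spow x (j * i.+1 + i).
Proof.
elim: j => [//|j IH]; rewrite spowS IH spowD.
by congr (spow x _); lia.
Qed.

Lemma spow_swap x y k :
  spow (fsg_mul x y) k.+1 = fsg_mul x (fsg_mul (spow (fsg_mul y x) k) y).
Proof.
elim: k => [|k IH]; first by rewrite spowS /= !fsg_assoc.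
by rewrite spowS IH (spowS (fsg_mul y x)) !fsg_assoc.
Qed.

(** By the pigeonhole principle two of the powers with indices 0, ..., n agree, at indices a < b <=
    n. From index n on, the powers then have period b - a, which divides n!. *)
Lemma spow_period x i j :
  fsg_card S <= i -> fsg_card S <= j -> i = j %[mod (fsg_card S)`!] ->
  spow x i = spow x j.
Proof.
set n := fsg_card S => ni nj eqij.
have /injectivePn[a [b neq_ab eq_ab]] : ~~ injectiveb (fun k : 'I_n.+1 => spow x k).
  by apply/injectiveP => /leq_card; rewrite !card_ord ltnn.
wlog lt_ab : a b neq_ab eq_ab / a < b.
  move=> W; case: (ltngtP a b) => [ab|ba|/val_inj ab]; first exact: W ab.
    by apply: (W b a) => //; rewrite eq_sym.
  by rewrite ab eqxx in neq_ab.
have stepd k : n <= k -> spow x (k + (b - a)) = spow x k.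
  move=> nk; have := ltn_ord b; rewrite ltnS => bn.
  case: (eqVneq k a) => [->|ka]; first by rewrite subnKC // ltnW.
  have -> : k = (a + (k - a).-1).+1 by lia.
  rewrite -spowD eq_ab spowD; congr (spow x _); lia.
have stepm k m : n <= k -> spow x (k + m * (b - a)) = spow x k.
  move=> nk; elim: m => [|m IH]; first by rewrite addn0.
  by rewrite mulSn addnCA addnC stepd // (leq_trans nk) ?leq_addr.
wlog le_ij : i j ni nj eqij / i <= j.
  by move=> W; case: (leqP i j) => [|/ltnW] ij; [|symmetry]; apply: W.
have /dvdnP[m jE] : b - a %| j - i.
  apply: (@dvdn_trans n`!); last by rewrite -eqn_mod_dvd // eq_sym; apply/eqP.
  by apply: dvdn_fact; have := ltn_ord b; lia.
by rewrite -(subnKC le_ij) jE stepm.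
Qed.

End Powers.

(** * Infinite exponents as coherent sequences of naturals *)

(** Such a sequence converges in the profinite completion, since its residues modulo each factorial
    stabilise. The lower bound keeps the limit out of the naturals. *)
Definition coherent (f : nat -> nat) : Prop :=
  (forall n, n`! <= f n) /\ (forall n m, n <= m -> f m = f n %[mod n`!]).

(** [spow x k] is the power [x^(k+1)], so [seqop f] has exponent [lim (f n + 1)]. *)
Definition seqop (f : nat -> nat) : NHat :=
  fun S phi => spow (phi tt) (f (fsg_card S)).

Lemma coherent_ge f n : coherent f -> n <= f n.
Proof. by case=> fge _; apply: leq_trans (fge n); apply: fact_geq. Qed.

Lemma spow_coherent (S : finSG) (x : elt S) f m :
  coherent f -> fsg_card S <= m -> spow x (f m) = spow x (f (fsg_card S)).
Proof.
move=> fc le_m; apply: spow_period; last by case: fc => _; apply.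
  exact: leq_trans (coherent_ge _ fc).
exact: coherent_ge.
Qed.

Lemma hom_spow (S T : finSG) (h : elt S -> elt T) (x : elt S) k :
  is_hom h -> h (spow x k) = spow (h x) k.
Proof. by move=> hh; elim: k => [//|k IH]; rewrite !spowS hh IH. Qed.

Lemma seqop_natural f : coherent f -> natural (seqop f).
Proof.
move=> fc S T h hh phi; rewrite /seqop.
case: (leqP (fsg_card S) (fsg_card T)) => [le_ST|/ltnW le_TS].
  by rewrite -(spow_coherent _ fc le_ST) hom_spow.
by rewrite hom_spow // (spow_coherent _ fc le_TS).
Qed.

(** * Finite monogenic semigroups as test objects for exponents *)

Definition wrap (M t : nat) : nat := if t < M then t else M + t %% M.

Lemma wrap_lt M t : 0 < M -> wrap M t < M + M.
Proof.
move=> M0; rewrite /wrap; case: (ltnP t M) => [|_]; first by lia.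
by rewrite ltn_add2l ltn_mod.
Qed.

Lemma wrapDl M a b : wrap M (wrap M a + b) = wrap M (a + b).
Proof.
rewrite {2}/wrap; case: (ltnP a M) => // Ma.
rewrite /wrap !ifN -?leqNgt; [|lia|lia].
by rewrite -addnA modnDl modnDml.
Qed.

Lemma wrapSDl M a b : wrap M (wrap M a + b).+1 = wrap M (a + b).+1.
Proof. by rewrite -addnS wrapDl addnS. Qed.

Lemma wrapSDr M a b : wrap M (a + wrap M b).+1 = wrap M (a + b).+1.
Proof. by rewrite addnC wrapSDl addnC. Qed.

Lemma wrap_dvd M N t : M <= N -> M %| N -> wrap M (wrap N t) = wrap M t.
Proof.
move=> MN dMN; rewrite {2}/wrap; case: (ltnP t N) => // Nt.
rewrite /wrap !ifN -?leqNgt; [|lia|lia].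
by rewrite -modnDm (modn_dvdm _ dMN) (eqP dMN) add0n modn_mod.
Qed.

Lemma wrap_mod M t : wrap M t = t %[mod M].
Proof. by rewrite /wrap; case: ifP => // _; rewrite modnDl modn_mod. Qed.

(** The monogenic semigroup with index and period [n!]; the element [i] is the
    [(i+1)]st power of the generator. *)
Section Monogenic.
Variable n : nat.

Definition mono_elt (t : nat) : 'I_(n`! + n`!) := Ordinal (wrap_lt t (fact_gt0 n)).

Lemma mono_assoc : associative (fun i j : 'I_(n`! + n`!) => mono_elt (i + j).+1).
Proof.
move=> i j k; apply: val_inj => /=.
by rewrite wrapSDl wrapSDr; congr wrap; lia.
Qed.

Definition mono : finSG := FinSG mono_assoc.

Definition mono_gen : elt mono := mono_elt 0.

Lemma mono_eltD a b : mono_elt (mono_elt a + mono_elt b).+1 = mono_elt (a + b).+1.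
Proof.
by apply: val_inj; rewrite /= wrapSDl wrapSDr.
Qed.

Lemma spow_mono_gen k : spow mono_gen k = mono_elt k :> elt mono.
Proof.
elim: k => [//|k IH]; rewrite spowS IH.
by rewrite /= /mono_gen mono_eltD addn0.
Qed.

End Monogenic.

(** By [spow_period], any element of [S] is the image of the generator under a homomorphism from
    [mono (fsg_card S)]. Naturality transports the value of [a] along it. *)
Lemma natural_mono (a : NHat) (S : finSG) (phi : unit -> elt S) :
  natural a ->
  a S phi = spow (phi tt) (nat_of_ord (a (mono (fsg_card S)) (fun=> mono_gen _))).
Proof.
move=> na; pose h (i : elt (mono (fsg_card S))) : elt S := spow (phi tt) (nat_of_ord i).
have spow_wrap t : spow (phi tt) (wrap (fsg_card S)`! t) = spow (phi tt) t.
  rewrite /wrap; case: ltnP => // le_t.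
  have le_n := fact_geq (fsg_card S).
  by apply: spow_period; [lia|lia|rewrite modnDl modn_mod].
have hh : is_hom h.
  by move=> i j; rewrite /h /= spow_wrap spowD.
rewrite -[RHS]/(h _) (na _ _ _ hh); congr (a S _).
apply: functional_extensionality_dep => -[]; rewrite /h /mono_gen /=.
by rewrite spow_wrap.
Qed.

(** The sequence records the values of [a] at the generators of the semigroups [mono n]; it is
    coherent because [mono m] maps onto [mono n] for n <= m. A value below n! lies before the
    periodic part and would make [a] a fixed finite power. *)
Lemma nonfinite_seqop (a : NHat) : natural a -> ~ finiteN a ->
  exists2 f, coherent f & a = seqop f.
Proof.
move=> na nfa.
pose f n : nat := nat_of_ord (a (mono n) (fun=> mono_gen n)).
have f_wrap n m : n <= m -> f n = wrap n`! (f m).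
  move=> le_nm; pose h (i : elt (mono m)) : elt (mono n) := mono_elt n (nat_of_ord i).
  have le_f : n`! <= m`! by apply: leq_fact.
  have dv_f : n`! %| m`! by apply: dvdn_fact_leq.
  have hE t : mono_elt n (wrap m`! t) = mono_elt n t.
    by apply: val_inj; rewrite /= wrap_dvd.
  have hh : is_hom h by move=> i j; rewrite /h /= hE mono_eltD.
  have -> : wrap n`! (f m) = nat_of_ord (h (a (mono m) (fun=> mono_gen m))) by [].
  rewrite (na _ _ _ hh) /f; congr (nat_of_ord (a _ _)).
  by apply: functional_extensionality_dep => _; rewrite /h /mono_gen /= hE.
have aE : a = seqop f.
  by apply: rawop_ext => S phi; rewrite (natural_mono _ na).
exists f => //; split=> [n|n m le_nm]; last first.
  by rewrite (f_wrap _ _ le_nm) wrap_mod.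
rewrite leqNgt; apply/negP => lt_f; apply: nfa; exists (f n) => S phi.
rewrite aE /seqop; case: (leqP n (fsg_card S)) => [le_n|/ltnW le_n].
  move: lt_f; rewrite (f_wrap _ _ le_n) /wrap; case: ifP => //= _.
  by rewrite ltnNge leq_addr.
rewrite (f_wrap _ _ le_n) /wrap; case: ltnP => // le_f.
have le_c := fact_geq (fsg_card S).
by apply: spow_period; [lia|lia|rewrite modnDl modn_mod].
Qed.

(** In [mono k.+1] the element of index k precedes the periodic part, whereas [seqop f] takes its
    value inside it. *)
Lemma seqop_not_finite f : coherent f -> ~ finiteN (seqop f).
Proof.
move=> fc [k fin]; pose n := k.+1.
have /(congr1 (@nat_of_ord _)) := fin (mono n) (fun=> mono_gen n).
rewrite /seqop !spow_mono_gen /= /wrap ltn_geF; last first.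
  apply: leq_trans (coherent_ge _ fc).
  by rewrite /= leq_addl.
by have := fact_geq n; rewrite /n => le_n; case: ifP; lia.
Qed.

(** Modulo n!, adding k(n! - 1) subtracts k, without truncated subtraction and without losing the
    lower bound. *)
Lemma coherent_shift f k : coherent f -> coherent (fun n => f n + k * (n`!).-1).
Proof.
case=> f_ge f_mod; split=> [n|n m le_nm]; first by rewrite (leq_trans (f_ge n)) ?leq_addr.
apply/eqP; rewrite -(eqn_modDr k).
have shiftK p : f p + k * (p`!).-1 + k = k * p`! + f p.
  by have := fact_gt0 p; case: (p`!) => // q _ /=; lia.
rewrite !shiftK modnMDl -modnDml.
have /eqP -> : n`! %| k * m`! by rewrite dvdn_mull ?dvdn_fact_leq.
by rewrite add0n f_mod.
Qed.

Lemma succN_shift f : coherent f ->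
  succN (seqop (fun n => f n + (n`!).-1)) = seqop f.
Proof.
move=> fc; apply: rawop_ext => S phi; rewrite /succN /seqop -spowS.
have := fact_gt0 (fsg_card S); have := coherent_ge (fsg_card S) fc => ge_f gt_f.
by apply: spow_period; [lia|lia|rewrite -addnS prednK ?modnDr].
Qed.

(** * Exponents of the completed signature and division by purity *)

Section Exponents.
Variable E : NHat -> Prop.
Hypothesis sigE : unary_signature E.

Lemma bar_coherent a : bar_exp E a -> exists2 f, coherent f & a = seqop f.
Proof.
elim=> [{}a Ea|{}a _ [f fc ->]|{}a b _ _ nb nfb _].
- by have [na nfa] := sigE.2 _ Ea; apply: nonfinite_seqop.
- exists (fun n => (f n).+1) => //; case: fc => f_ge f_mod.
  split=> [n|n m le_nm]; first exact: leqW.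
  by rewrite -addn1 -modnDml f_mod // modnDml addn1.
- exact: nonfinite_seqop.
Qed.

Lemma bar_shift f k : coherent f -> bar_exp E (seqop f) ->
  bar_exp E (seqop (fun n => f n + k * (n`!).-1)).
Proof.
move=> fc Ef; elim: k => [|k IH].
  by congr (bar_exp E (seqop _)): Ef; apply: functional_extensionality_dep => n;
    rewrite mul0n addn0.
have gc := coherent_shift k fc; have hc := coherent_shift k.+1 fc.
apply: (bar_pred IH); [exact: seqop_natural|exact: seqop_not_finite|].
rewrite -(succN_shift gc); congr (succN (seqop _)).
by apply: functional_extensionality_dep => n; lia.
Qed.

Lemma bar_pred_ex a : bar_exp E a -> exists2 b, bar_exp E b & succN b = a.
Proof.
move=> Ea; have [f fc aE] := bar_coherent Ea; rewrite {}aE in Ea *.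
exists (seqop (fun n => f n + 1 * (n`!).-1)); first exact: bar_shift.
rewrite -[RHS]succN_shift //; congr (succN (seqop _)).
by apply: functional_extensionality_dep => n; rewrite mul1n.
Qed.

(** With [al = lim (f n + 1)], purity yields the exponent [be = (al - k) / c]. *)
Lemma bar_div f c k m : pure E -> coherent f -> bar_exp E (seqop f) ->
  0 < c <= m -> k + c = (f m).+1 ->
  exists g, [/\ coherent g, bar_exp E (seqop g)
    & forall n, c * (g n).+1 + k = (f n).+1 %[mod n`!]].
Proof.
move=> pureE fc Ef /andP[c_gt0 le_cm] kcE.
(* [seqop h] has exponent al - k. It is divisible by c because (f m).+1 - k = c and residues modulo
   c are constant from index c on. *)
pose h n := f n + k * (n`!).-1.
have hc : coherent h := coherent_shift k fc.
have hK n : (h n).+1 + k = k * n`! + (f n).+1.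
  by rewrite /h; have := fact_gt0 n; case: (n`!) => // q _ /=; lia.
have modW p q n : p = q %[mod n`!] -> c <= n -> p = q %[mod c].
  move=> pq le_cn; have c_dvd : c %| n`! by apply: dvdn_fact; rewrite c_gt0.
  by rewrite -(modn_dvdm p c_dvd) pq modn_dvdm.
have f_modc n p : n <= p -> c <= n -> f p = f n %[mod c].
  by move=> le_np; apply: modW; apply: fc.2.
have h_dvd n : c <= n -> c %| (h n).+1.
  move=> le_cn; rewrite /dvdn -(mod0n c) -(eqn_modDr k) hK add0n -modnDml.
  have /eqP -> : c %| k * n`! by rewrite dvdn_mull // dvdn_fact ?c_gt0.
  rewrite add0n -addn1 -modnDml (_ : f n = f m %[mod c]).
    by rewrite modnDml addn1 -kcE modnDr.
  by rewrite (f_modc _ _ le_cm) // (f_modc _ _ le_cn).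
(* The index is moved to c + n because c * n! divides (c + n)!, so the quotient by c is determined
   modulo n!. *)
pose q n := (h (c + n)).+1 %/ c.
have qE n : c * q n = (h (c + n)).+1 by rewrite mulnC divnK ?h_dvd ?leq_addr.
have q_gt0 n : 0 < q n by have := qE n; case: (q n) => //; rewrite muln0.
have q_mod n p : n <= p -> q p = q n %[mod n`!].
  move=> le_np; apply/eqP; rewrite -(eqn_pmul2l c_gt0) !muln_modr !qE.
  have dv : c * n`! %| (c + n)`!.
    rewrite -(bin_fact (leq_addr n c)) addKn dvdn_mull // dvdn_mul //.
    by rewrite dvdn_fact // c_gt0 leqnn.
  rewrite -addn1 -(addn1 (h _)) eqn_modDr -(modn_dvdm _ dv) hc.2 ?leq_add2l //.
  by rewrite modn_dvdm.
(* The predecessor accounts for the offset of [spow]; the summand n! provides the lower bound of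
   [coherent]. *)
pose g n := (q n).-1 + n`!.
have gS n : (g n).+1 = q n + n`! by rewrite /g -addSn prednK.
have gc : coherent g.
  split=> [n|n p le_np]; first exact: leq_addl.
  apply/eqP; rewrite -(eqn_modDr 1) !addn1 !gS modnDr -modnDmr.
  by rewrite (eqP (dvdn_fact_leq le_np)) addn0 q_mod.
have cgE n : c * (g n).+1 = (h (c + n)).+1 + c * n`! by rewrite gS mulnDr qE.
have h_mod n : c * (g n).+1 = (h n).+1 %[mod n`!].
  rewrite cgE addnC modnMDl -addn1 -modnDml hc.2 ?leq_addl //.
  by rewrite modnDml addn1.
exists g; split=> // [|n]; last first.
  by rewrite -modnDml h_mod modnDml hK modnMDl.
apply: (pureE c) => //; first exact: seqop_natural.
rewrite (_ : dmulN c (seqop g) = seqop h); first exact: bar_shift.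
apply: rawop_ext => S phi; rewrite /dmulN /seqop spow_spow.
set n := fsg_card S.
have E1 : (c.-1 * (g n).+1 + g n).+1 = c * (g n).+1.
  by rewrite -addnS -mulSnr prednK.
apply: spow_period.
- by rewrite (leq_trans (coherent_ge n gc)) ?leq_addl.
- exact: coherent_ge.
- by apply/eqP; rewrite -(eqn_modDr 1) !addn1 E1 h_mod.
Qed.

End Exponents.

(** * Limits of elements of a multiplicatively closed set *)

Section Approximation.
Variables (X : Type) (A : rawop X -> Prop).
Implicit Types u v : rawop X.

Definition approx u : Prop := forall ts : list {S : finSG & X -> elt S},
  exists a, A a /\
    forall t, lIn t ts -> a (projT1 t) (projT2 t) = u (projT1 t) (projT2 t).

Hypothesis A_mul : forall u v, A u -> A v -> A (mulop u v).

Lemma approx_mul u v : approx u -> approx v -> approx (mulop u v).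
Proof.
move=> Au Av ts; have [a [Aa au]] := Au ts; have [b [Ab bv]] := Av ts.
exists (mulop a b); split; first exact: A_mul.
by move=> t t_ts; rewrite /mulop au // bv.
Qed.

(** If m bounds the sizes of the finitely many test semigroups, the single finite power of index
    [f m] computes the infinite power in all of them. *)
Lemma approx_pow f u : coherent f -> approx u -> approx (powop (seqop f) u).
Proof.
move=> fc Au ts; have [a [Aa au]] := Au ts.
have [m le_m] : exists m, forall t, lIn t ts -> fsg_card (projT1 t) <= m.
  elim: ts {Au au} => [|s ts [m le_m]]; first by exists 0.
  exists (maxn (fsg_card (projT1 s)) m) => t /= [<-|/le_m le_t].
    exact: leq_maxl.
  by rewrite (leq_trans le_t) ?leq_maxr.
exists (fun S phi => spow (a S phi) (f m)); split.
  by elim: (f m) => [//|k IH]; apply: A_mul IH Aa.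
by move=> t t_ts; rewrite au // (spow_coherent _ fc (le_m t t_ts)).
Qed.

End Approximation.

(** * Automata for rational languages *)

Section Automata.
Variable X : Type.
Implicit Types (L : seq X -> Prop) (w : seq X).

Record nfa := Nfa {
  state : finType;
  initial : pred state;
  final : pred state;
  step : X -> rel state }.

Fixpoint path_rel (Q : finType) (M : X -> rel Q) (p : Q) w (q : Q) : bool :=
  if w is x :: w' then [exists r, M x p r && path_rel M r w' q] else p == q.

Lemma path_relP (Q : finType) (M : X -> rel Q) p x w q :
  reflect (exists2 r, M x p r & path_rel M r w q) (path_rel M p (x :: w) q).
Proof.
by apply: (iffP existsP) => [[r /andP[]]|[r pr rq]]; exists r => //; apply/andP.
Qed.

Lemma path_rel_cat (Q : finType) (M : X -> rel Q) p w1 w2 q :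
  path_rel M p (w1 ++ w2) q <->
  exists2 r, path_rel M p w1 r & path_rel M r w2 q.
Proof.
elim: w1 p => [|x w1 IH] p.
  by split=> [pq|[r /eqP -> //]]; exists p => //=.
split=> [/path_relP[r pr /IH[s rs sq]]|[s /path_relP[r pr rs] sq]].
  by exists s => //; apply/path_relP; exists r.
by apply/path_relP; exists r => //; apply/IH; exists s.
Qed.

Lemma path_rel_sub (Q : finType) (M M' : X -> rel Q) p w q :
  (forall x r s, M x r s -> M' x r s) -> path_rel M p w q -> path_rel M' p w q.
Proof.
move=> sub; elim: w p => [//|x w IH] p /path_relP[r /sub pr /IH rq].
by apply/path_relP; exists r.
Qed.

Definition accepts (B : nfa) w : Prop :=
  exists i f, [/\ initial i, final f & path_rel (@step B) i w f].

(** Without the empty word, every factor has a first letter, on which [enters] can start it. *)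
Definition recognizes (B : nfa) L : Prop :=
  ~ L [::] /\ forall w, L w <-> accepts B w.

(** Reading a letter as the first one of a new word: this lets automata be
    concatenated and iterated without empty transitions. *)
Definition enters (B : nfa) x (q : state B) : bool :=
  [exists i, initial i && step x i q].

Lemma accepts_cons (B : nfa) x w :
  accepts B (x :: w) <->
  exists q f, [/\ enters x q, final f & path_rel (@step B) q w f].
Proof.
split=> [[i [f [ini fin /path_relP[q iq qf]]]]|[q [f [/existsP[i /andP[ini iq]] fin qf]]]].
  by exists q, f; split=> //; apply/existsP; exists i; rewrite ini.
by exists i, f; split=> //; apply/path_relP; exists q.
Qed.

Definition nfa_plus (B : nfa) : nfa :=
  @Nfa (state B) (@initial B) (@final B)
    (fun x p q => step x p q || final p && enters x q).

(** The path is cut at its first reset: [w1] is read before it, and what follows decomposes into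
    words of [L] because [q] is final. *)
Lemma path_plus (B : nfa) L p w q : (forall w, L w <-> accepts B w) -> final q ->
  path_rel (@step (nfa_plus B)) p w q ->
  path_rel (@step B) p w q \/
  exists w1 w2 f, [/\ w = w1 ++ w2, final f, path_rel (@step B) p w1 f & plus_of L w2].
Proof.
move=> BL finq; elim: w p => [|x w IH] p; first by left.
case/path_relP=> r /= /orP[pr|/andP[finp ent]] /IH[rq|[w1 [w2 [f [-> finf rf Lw2]]]]].
- by left; apply/path_relP; exists r.
- right; exists (x :: w1), w2, f; split=> //; apply/path_relP.
  by exists r.
- right; exists [::], (x :: w), p; split=> //=.
  by apply/plus_base/BL/accepts_cons; exists r, q.
right; exists [::], (x :: w1 ++ w2), p; split=> //=.
rewrite -cat_cons; apply: plus_step Lw2.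
by apply/BL/accepts_cons; exists r, f.
Qed.

Lemma plus_of_nil L : plus_of L [::] -> L [::].
Proof.
suff nil_plus w : plus_of L w -> w = [::] -> L [::] by move/nil_plus; apply.
by case=> {w} [w Lw <-|[|//] v Lu _ _].
Qed.

Lemma plus_of_cat L u v : plus_of L u -> plus_of L v -> plus_of L (u ++ v).
Proof.
elim=> {u} [u Lu|u w Lu _ IH] Lv; first exact: plus_step.
by rewrite -catA; apply: plus_step Lu (IH Lv).
Qed.

Lemma recognizes_plus (B : nfa) L : recognizes B L -> recognizes (nfa_plus B) (plus_of L).
Proof.
move=> [L0 BL]; split; first by move/plus_of_nil.
move=> w; split.
  have lift u : accepts B u -> accepts (nfa_plus B) u.
    move=> [i [f [ini fin uif]]]; exists i, f; split=> //.
    by apply: path_rel_sub uif => x r s /= ->.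
  elim=> {w} [w /BL/lift//|u v /BL/lift[i [f [ini fin uif]]]].
  case: v => [/plus_of_nil//|x v] _ /accepts_cons[q [g [ent fing vqg]]].
  exists i, g; split=> //; apply/path_rel_cat; exists f => //.
  apply/path_relP; exists q => //=; apply/orP; right; rewrite fin /=.
  (* The entering step of [nfa_plus B] may itself be a reset; in both cases [x] enters [q] in
     [B]. *)
  case/existsP: ent => j /andP[inj] /= /orP[jq|/andP[_ //]].
  by apply/existsP; exists j; rewrite inj.
case=> i [f [ini fin]] /(path_plus BL fin)[wif|].
  by apply/plus_base/BL; exists i, f.
case=> w1 [w2 [g [-> fing ig Lw2]]]; apply: plus_step Lw2.
by apply/BL; exists i, g.
Qed.

Lemma recognizes_empty : recognizes (@Nfa bool pred0 pred0 (fun _ _ _ => false)) (fun=> False).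
Proof. by split=> // w; split=> // -[i [f []]]. Qed.

(** No edge leaves the image of [e], so a path starting there stays there. This applies to both
    summands of a union and to the second component of a concatenation. *)
Lemma path_rel_embed (Q Q' : finType) (M : X -> rel Q) (M' : X -> rel Q') (e : Q -> Q') :
  injective e -> (forall x p r, M' x (e p) (e r) = M x p r) ->
  (forall x p s, M' x (e p) s -> exists r, s = e r) ->
  forall p w s, path_rel M' (e p) w s <-> exists2 q, s = e q & path_rel M p w q.
Proof.
move=> e_inj eM e_closed p w s; split=> [|[q ->]].
  elim: w p => [|x w IH] p; first by move/eqP <-; exists p => /=.
  case/path_relP=> r pr; have [r' rE] := e_closed _ _ _ pr.
  rewrite {}rE in pr *; case/IH=> q -> rq; exists q => //.
  by apply/path_relP; exists r' => //; rewrite -eM.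
elim: w p => [|x w IH] p; first by move/eqP->; apply: eqxx.
by case/path_relP=> r pr /IH rq; apply/path_relP; exists (e r); rewrite ?eM.
Qed.

Definition nfa_union (B C : nfa) : nfa :=
  @Nfa (state B + state C)%type
    (fun p => match p with inl p => initial p | inr p => initial p end)
    (fun p => match p with inl p => final p | inr p => final p end)
    (fun x p q => match p, q with
       | inl p, inl q => step x p q
       | inr p, inr q => step x p q
       | _, _ => false
     end).

Lemma path_union_inl (B C : nfa) p w q :
  path_rel (@step (nfa_union B C)) (inl p) w q <->
  exists2 q', q = inl q' & path_rel (@step B) p w q'.
Proof. by apply: path_rel_embed => [? ? [] //|//|x r [s|s] // _]; exists s. Qed.

Lemma path_union_inr (B C : nfa) p w q :
  path_rel (@step (nfa_union B C)) (inr p) w q <->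
  exists2 q', q = inr q' & path_rel (@step C) p w q'.
Proof. by apply: path_rel_embed => [? ? [] //|//|x r [s|s] // _]; exists s. Qed.

Lemma recognizes_union (B C : nfa) K L : recognizes B K -> recognizes C L ->
  recognizes (nfa_union B C) (fun w => K w \/ L w).
Proof.
move=> [K0 BK] [L0 CL]; split; first by case.
move=> w; split.
  case=> [/BK|/CL] [i [f [ini fin wif]]].
    by exists (inl i), (inl f); split=> //; apply/path_union_inl; exists f.
  by exists (inr i), (inr f); split=> //; apply/path_union_inr; exists f.
case=> [[i|i] [f [/= ini fin]]].
  case/path_union_inl=> f' fE wif; rewrite fE in fin.
  by left; apply/BK; exists i, f'.
case/path_union_inr=> f' fE wif; rewrite fE in fin.
by right; apply/CL; exists i, f'.
Qed.

Definition nfa_cat (B C : nfa) : nfa :=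
  @Nfa (state B + state C)%type
    (fun p => if p is inl p then initial p else false)
    (fun p => if p is inr p then final p else false)
    (fun x p q => match p, q with
       | inl p, inl q => step x p q
       | inr p, inr q => step x p q
       | inl p, inr q => final p && enters x q
       | inr _, inl _ => false
     end).

Lemma path_cat_inr (B C : nfa) p w q :
  path_rel (@step (nfa_cat B C)) (inr p) w q <->
  exists2 q', q = inr q' & path_rel (@step C) p w q'.
Proof. by apply: path_rel_embed => [? ? [] //|//|x r [s|s] // _]; exists s. Qed.

Lemma path_cat_inl (B C : nfa) p w q :
  path_rel (@step B) p w q -> path_rel (@step (nfa_cat B C)) (inl p) w (inl q).
Proof.
elim: w p => [|x w IH] p; first by move/eqP->; apply: eqxx.
by case/path_relP=> r pr /IH rq; apply/path_relP; exists (inl r).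
Qed.

Lemma path_cat (B C : nfa) p w q :
  path_rel (@step (nfa_cat B C)) (inl p) w (inr q) ->
  exists w1 f x w2 r, [/\ w = w1 ++ x :: w2, path_rel (@step B) p w1 f, final f,
    enters x r & path_rel (@step C) r w2 q].
Proof.
elim: w p => [//|x w IH] p /path_relP[[r|r]] /= pr.
  move/IH=> [w1 [f [y [w2 [s [-> rf finf ent sq]]]]]].
  by exists (x :: w1), f, y, w2, s; split=> //; apply/path_relP; exists r.
case/path_cat_inr=> q' [<-] rq; case/andP: pr => finp ent.
by exists [::], p, x, w, r; split=> //=.
Qed.

Lemma recognizes_cat (B C : nfa) K L : recognizes B K -> recognizes C L ->
  recognizes (nfa_cat B C) (fun w => exists u v, w = u ++ v /\ K u /\ L v).
Proof.
move=> [K0 BK] [L0 CL]; split.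
  by case=> u [v [+ [+ _]]]; case: u.
move=> w; split.
  case=> u [v [-> [/BK[i [f [ini fin uif]]] Lv]]].
  case: v Lv => [//|x v] /CL/accepts_cons[q [g [ent fing qg]]].
  exists (inl i), (inr g); split=> //; apply/path_rel_cat.
  exists (inl f); first exact: path_cat_inl.
  apply/path_relP; exists (inr q); first by rewrite /= fin.
  by apply/path_cat_inr; exists g.
case=> -[i|i] [[f|f] [// ini fin]] /=.
case/path_cat=> w1 [g [x [w2 [r [-> ig fing ent rf]]]]].
exists w1, (x :: w2); split=> //; split; first by apply/BK; exists i, g.
by apply/CL/accepts_cons; exists r, f.
Qed.

End Automata.

Lemma recognizes_sym (X : eqType) (x : X) :
  recognizes (@Nfa X bool negb id (fun y p q => [&& y == x, ~~ p & q])) (fun w => w = [:: x]).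
Proof.
split=> // w; split=> [->|].
  by exists false, true; split=> //; apply/path_relP; exists true; rewrite /= ?eqxx.
case=> -[] [[] [//= _ _]].
case: w => [//|y w] /path_relP[r /and3P[/eqP-> _ /= r_true]]; rewrite r_true.
by case: w => [//|z w] /path_relP[s /and3P[]].
Qed.

Lemma rational_recognizes (X : eqType) (L : seq X -> Prop) :
  rational L -> exists B, recognizes B L.
Proof.
case=> e LE.
have [B [B0 BE]] : exists B, recognizes B (rlang e).
  elim: e {LE} => [|x|e [B Be] f [C Cf]|e [B Be] f [C Cf]|e [B Be]].
  - by exists (@Nfa X bool pred0 pred0 (fun _ _ _ => false)); apply: recognizes_empty.
  - by exists (@Nfa X bool negb id (fun y p q => [&& y == x, ~~ p & q])); apply: recognizes_sym.
  - by exists (nfa_union B C); apply: recognizes_union.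
  - by exists (nfa_cat B C); apply: recognizes_cat.
  - by exists (nfa_plus B); apply: recognizes_plus.
by exists B; split=> [/LE//|w]; rewrite LE.
Qed.

(** * The semigroup of relations on the states *)

Section RelationSemigroup.
Variable Q : finType.

Definition rel_comp (A B : {set Q * Q}) : {set Q * Q} :=
  [set pq | [exists r, ((pq.1, r) \in A) && ((r, pq.2) \in B)]].

Lemma in_rel_comp (A B : {set Q * Q}) (p q : Q) :
  reflect (exists2 r, (p, r) \in A & (r, q) \in B) ((p, q) \in rel_comp A B).
Proof.
by rewrite inE; apply: (iffP existsP) => [[r /andP[]]|[r pr rq]]; exists r => //; apply/andP.
Qed.

Lemma rel_compA : associative rel_comp.
Proof.
move=> A B C; apply/setP => -[p q]; apply/in_rel_comp/in_rel_comp.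
  move=> [r pr /in_rel_comp[s rs sq]]; exists s => //.
  by apply/in_rel_comp; exists r.
move=> [s /in_rel_comp[r pr rs] sq]; exists r => //.
by apply/in_rel_comp; exists s.
Qed.

(** Carriers of [finSG] are ordinals, so composition is transported along the enumeration of
    relations. *)
Lemma relsem_assoc : associative (fun a b : 'I_#|{: {set Q * Q}}| =>
  enum_rank (rel_comp (enum_val a) (enum_val b))).
Proof. by move=> a b c; rewrite !enum_rankK rel_compA. Qed.

Definition relsem : finSG := FinSG relsem_assoc.

Variables (X : Type) (M : X -> rel Q).

Definition labels (u : rawop X) (p q : Q) : bool :=
  (p, q) \in enum_val (u relsem (fun x => enum_rank [set pq | M x pq.1 pq.2])
                        : 'I_#|{: {set Q * Q}}|).

Lemma labels_letter x p q : labels (letter x) p q = M x p q.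
Proof. by rewrite /labels /letter enum_rankK inE. Qed.

Lemma labels_mul u v p q :
  reflect (exists2 r, labels u p r & labels v r q) (labels (mulop u v) p q).
Proof. by rewrite /labels /mulop /= enum_rankK; apply: in_rel_comp. Qed.

End RelationSemigroup.

(** * Words as implicit operations *)

Section Words.
Variable X : Type.

Lemma word_op_rcons (x y : X) t : word_op x (rcons t y) = mulop (word_op x t) (letter y).
Proof. by rewrite /word_op map_rcons foldl_rcons. Qed.

Lemma word_op_mul (x y : X) t s :
  mulop (word_op x t) (word_op y s) = word_op x (t ++ y :: s).
Proof.
elim/last_ind: s => [|s z IH]; first by rewrite cats1 word_op_rcons.
by rewrite -rcons_cons -rcons_cat !word_op_rcons mulopA IH.
Qed.

Lemma labels_word (Q : finType) (M : X -> rel Q) x t p q :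
  labels M (word_op x t) p q <-> path_rel M p (x :: t) q.
Proof.
elim/last_ind: t q => [|t y IH] q.
  rewrite labels_letter; split=> [pq|/path_relP[r pr /eqP <-] //].
  by apply/path_relP; exists q => //=.
rewrite word_op_rcons -rcons_cons -cats1 path_rel_cat; split.
  case/labels_mul=> r /IH pr; rewrite labels_letter => rq.
  by exists r => //; apply/path_relP; exists q => //=.
case=> r /IH pr /path_relP[s rs /eqP <-]; apply/labels_mul.
by exists r; rewrite ?labels_letter.
Qed.

Lemma lang_image_plus_mul (L : seq X -> Prop) u v :
  lang_image (plus_of L) u -> lang_image (plus_of L) v ->
  lang_image (plus_of L) (mulop u v).
Proof.
move=> [x [t [Lxt ->]]] [y [s [Lys ->]]]; exists x, (t ++ y :: s).
by rewrite word_op_mul; split=> //; apply: (plus_of_cat Lxt Lys).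
Qed.

End Words.

(** * Powers with exponents in the completed signature *)

Section BarPowers.
Variables (X : Type) (E : NHat -> Prop).
Hypothesis kappaE : contains_kappa E.

(** A successor exponent adds one factor [u]. A predecessor b is recovered from u^b = u^(b+1)
    u^(omega-1), valid because b is infinite. *)
Lemma bar_exp_closed (P : rawop X -> Prop) a u :
  (forall u v, P u -> P v -> P (mulop u v)) ->
  (forall a u, E a -> P u -> P (powop a u)) ->
  bar_exp E a -> P u -> P (powop a u).
Proof.
move=> P_mul P_pow Ea Pu; elim: Ea => [{}a Ea|{}a _ Pa|{}a b _ Pa nb nfb baE].
- exact: P_pow.
- exact: (P_mul _ _ Pa Pu).
have [f fc bE] := nonfinite_seqop nb nfb.
suff -> : powop b u = mulop (powop a u) (powop omega_m1 u).
  exact: P_mul (P_pow _ _ kappaE Pu).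
rewrite -baE bE; apply: rawop_ext => S phi.
rewrite /mulop /powop /succN /seqop /omega_m1 -spowS spowD.
have ge_f := coherent_ge (fsg_card S) fc; have := fact_gt0 (fsg_card S) => gt_f.
apply: spow_period; [lia|lia|].
have -> : ((f (fsg_card S)).+1 + (2 * (fsg_card S)`! - 2)).+1 =
  2 * (fsg_card S)`! + f (fsg_card S) by lia.
by rewrite modnMDl.
Qed.

End BarPowers.

(** * Finite powers as walks on the states *)

Section Walks.
Variables (X : Type) (Q : finType) (M : X -> rel Q).

Definition vpow (u : rawop X) (k : nat) : rawop X := fun S phi => spow (u S phi) k.

Lemma vpow_walk u k p q : labels M (vpow u k) p q ->
  exists s : nat -> Q, [/\ s 0 = p, s k.+1 = q
    & forall i, i <= k -> labels M u (s i) (s i.+1)].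
Proof.
elim: k q => [|k IH] q.
  by move=> pq; exists (fun i => if i is 0 then p else q); split=> // -[].
case/labels_mul=> r /IH[s [s0 sk s_step]] rq.
exists (fun i => if i <= k.+1 then s i else q); split=> //; first by rewrite ltnn.
move=> i le_i; rewrite le_i; case: (ltnP i k.+1) => [lt_i|ge_i]; first exact: s_step.
by rewrite (_ : i = k.+1) ?sk //; lia.
Qed.

Lemma labels_vpow u k p : labels M u p p -> labels M (vpow u k) p p.
Proof. by move=> pp; elim: k => [//|k IH]; apply/labels_mul; exists p. Qed.

End Walks.

(** * The two inclusions between the closure and the generated subalgebra *)

Section PlusClosure.
Variables (X : Type) (E : NHat -> Prop) (B : nfa X) (L : seq X -> Prop).
Hypotheses (sigE : unary_signature E) (kappaE : contains_kappa E).
Hypothesis BL : recognizes B L.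

Implicit Types (a : NHat) (u v g d b : rawop X) (A : rawop X -> Prop).

Local Notation closure L := (closure_in E (lang_image L)).
Local Notation step1 := (@step X B).
Local Notation step_plus := (@step X (nfa_plus B)).

Lemma omega_approx u :
  omega_sigma E u -> approx (fun a : rawop X => exists x t, a = word_op x t) u.
Proof.
have mul_words (u1 u2 : rawop X) : (exists x t, u1 = word_op x t) ->
    (exists x t, u2 = word_op x t) -> exists x t, mulop u1 u2 = word_op x t.
  by move=> [x [t ->]] [y [s ->]]; exists x, (t ++ y :: s); apply: word_op_mul.
elim=> {u} [x|u v _ Au _ Av|a u Ea _ Au].
- by move=> ts; exists (letter x); split=> //; exists x, [::].
- exact: approx_mul.
have [f fc ->] := bar_coherent sigE (bar_base Ea).
exact: approx_pow.
Qed.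

Lemma omega_pow a u : bar_exp E a -> omega_sigma E u -> omega_sigma E (powop a u).
Proof.
apply: (bar_exp_closed kappaE (P := omega_sigma E)) => [v w|b v].
  exact: os_mul.
exact: os_pow.
Qed.

Lemma gen_pow A a u : bar_exp E a -> gen_sub E A u -> gen_sub E A (powop a u).
Proof.
apply: (bar_exp_closed kappaE (P := gen_sub E A)) => [v w|b v].
  exact: gs_mul.
exact: gs_pow.
Qed.

(** The closure of L^+ contains that of [L] and is stable under products and, through approximation
    by finite powers, under sigma-powers. *)
Lemma gen_closure_plus u :
  gen_sub E (closure L) u -> closure (plus_of L) u.
Proof.
elim=> {u} [u [os_u cl_u]|u v _ [os_u cl_u] _ [os_v cl_v]|a u Ea _ [os_u cl_u]].
- split=> // ts; have [a [[x [t [Lxt aE]]] a_u]] := cl_u ts.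
  by exists a; split=> //; exists x, t; split=> //; apply: plus_base.
- split; first exact: os_mul.
  by apply: approx_mul => // ? ?; apply: lang_image_plus_mul.
split; first exact: os_pow.
have [f fc ->] := bar_coherent sigE (bar_base Ea).
by apply: approx_pow => // ? ?; apply: lang_image_plus_mul.
Qed.

(** An operation read inside a single factor, with no reset. *)
Definition arrow u p q : Prop := omega_sigma E u /\ labels step1 u p q.

Lemma arrow_mul u v p q r : arrow u p q -> arrow v q r -> arrow (mulop u v) p r.
Proof.
move=> [os_u pq] [os_v qr]; split; first exact: os_mul.
by apply/labels_mul; exists q.
Qed.

Lemma arrow_pow a u p : bar_exp E a -> arrow u p p -> arrow (powop a u) p p.
Proof.
move=> Ea [os_u pp]; split; first exact: omega_pow.
have [f fc ->] := bar_coherent sigE Ea.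
exact: (labels_vpow (f (fsg_card (relsem (state B)))) pp).
Qed.

(** Adding the relation semigroup of [B] to the test semigroups forces the approximating word to
    label the same accepting path, hence to lie in [L]. *)
Lemma arrow_closure u i f : initial i -> final f -> arrow u i f -> closure L u.
Proof.
move=> ini fin [os_u u_if]; split=> // ts.
have [a [[x [t aE]] a_u]] := omega_approx os_u
  (existT (fun S => X -> elt S) (relsem (state B))
     (fun x => enum_rank [set pq | step1 x pq.1 pq.2]) :: ts).
exists a; split=> [|s s_ts]; last by apply: a_u; right.
exists x, t; split=> //; apply/BL.2; exists i, f; split=> //.
by apply/labels_word; rewrite -aE /labels; have /= -> := a_u _ (or_introl erefl).
Qed.

(** [tail u q]: the operation [u] is a product of elements of the closure of
    [L], followed by an unfinished factor leading from an initial state to [q]. *)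
Definition tail u q : Prop := exists2 i, initial i &
  arrow u i q \/ exists g b : rawop X, [/\ u = mulop g b, gen_sub E (closure L) g & arrow b i q].

(** The cases are: no reset, a reset at the very start, and a first reset after a prefix [a]. The
    last two are separate because there is no empty operation. *)
Definition crossing u p q : Prop :=
  [\/ arrow u p q, final p /\ tail u q
    | exists (a d : rawop X) f, [/\ u = mulop a d, final f, arrow a p f & tail d q]].

Lemma tail_mul u v p q : tail u p -> arrow v p q -> tail (mulop u v) q.
Proof.
move=> [i ini [u_ip|[g [b [-> Gg b_ip]]]]] v_pq; exists i => //.
  by left; apply: arrow_mul v_pq.
right; exists g, (mulop b v); rewrite mulopA; split=> //.
exact: arrow_mul v_pq.
Qed.

Lemma gen_tail g u q : gen_sub E (closure L) g -> tail u q -> tail (mulop g u) q.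
Proof.
move=> Gg [i ini [u_iq|[h [b [-> Gh b_iq]]]]]; exists i => //; right.
  by exists g, u.
by exists (mulop g h), b; rewrite mulopA; split=> //; apply: gs_mul.
Qed.

Lemma tail_final u f : final f -> tail u f -> gen_sub E (closure L) u.
Proof.
move=> fin [i ini [u_if|[g [b [-> Gg b_if]]]]].
  exact/gs_base/(arrow_closure ini fin).
exact/(gs_mul Gg)/gs_base/(arrow_closure ini fin).
Qed.

Lemma crossing_arrow u v p q r :
  crossing u p q -> arrow v q r -> crossing (mulop u v) p r.
Proof.
move=> [u_pq|[finp Tu]|[a [d [f [-> fin a_pf Td]]]]] v_qr.
- by constructor 1; apply: arrow_mul v_qr.
- by constructor 2; split=> //; apply: tail_mul v_qr.
constructor 3; exists a, (mulop d v), f; rewrite mulopA; split=> //.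
exact: tail_mul v_qr.
Qed.

(** The reset at [q] completes the unfinished factor of [u], so the tail of [u] joins the generated
    subalgebra. *)
Lemma crossing_tail u v p q r :
  crossing u p q -> final q -> tail v r -> crossing (mulop u v) p r.
Proof.
move=> [u_pq|[finp Tu]|[a [d [f [-> fin a_pf Td]]]]] finq Tv.
- by constructor 3; exists u, v, q.
- by constructor 2; split=> //; apply: gen_tail Tv; apply: tail_final Tu.
constructor 3; exists a, (mulop d v), f; rewrite mulopA; split=> //.
by apply: gen_tail Tv; apply: tail_final Td.
Qed.

Lemma crossing_mul u v p q r :
  crossing u p q -> crossing v q r -> crossing (mulop u v) p r.
Proof.
move=> Cu [v_qr|[finq Tv]|[a [d [f [-> fin a_qf Td]]]]].
- exact: crossing_arrow Cu v_qr.
- exact: crossing_tail Cu finq Tv.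
by rewrite mulopA; apply: crossing_tail (crossing_arrow Cu a_qf) fin Td.
Qed.

(** If the loop [u = a d] leaves the current factor, then
    [(a d)^(be+1) = a (d a)^be d] with [d a] in the generated subalgebra. *)
Lemma crossing_pow a u p : bar_exp E a -> crossing u p p -> crossing (powop a u) p p.
Proof.
move=> Ea [u_pp|[finp Tu]|[b [d [f [uE fin b_pf Td]]]]].
- by constructor 1; apply: arrow_pow.
- have [a' Ea' <-] := bar_pred_ex sigE Ea.
  constructor 2; split=> //; apply: (@gen_tail (powop a' u)) => //.
  by apply: gen_pow => //; apply: tail_final Tu.
have [a' Ea' <-] := bar_pred_ex sigE Ea.
have [g gc aE] := bar_coherent sigE Ea'; rewrite {}aE in Ea' *.
constructor 3; exists b, (mulop (powop (seqop g) (mulop d b)) d), f; split=> //.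
  by rewrite uE; apply: rawop_ext => S phi; apply: spow_swap.
apply: gen_tail => //; apply: gen_pow => //.
exact/(tail_final fin)/(tail_mul Td).
Qed.

Lemma crossing_letter x p q : step_plus x p q -> crossing (letter x) p q.
Proof.
have arr r s : step1 x r s -> arrow (letter x) r s.
  by move=> rs; split; [exact: os_letter|rewrite labels_letter].
move=> /= /orP[/arr pq|/andP[finp /existsP[i /andP[ini /arr iq]]]].
  by constructor 1.
by constructor 2; split=> //; exists i => //; left.
Qed.

Lemma crossing_vpow u (s : nat -> state B) k :
  (forall i, i <= k -> crossing u (s i) (s i.+1)) ->
  crossing (vpow u k) (s 0) (s k.+1).
Proof.
elim: k => [|k IH] Cu; first exact: (Cu 0).
apply: (@crossing_mul (vpow u k) u) (Cu k.+1 _) => //.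
by apply: IH => i le_i; apply: Cu; apply: leqW.
Qed.

Hypothesis pureE : pure E.

Lemma crossing_powop a u p q : bar_exp E a ->
  (forall r s, labels step_plus u r s -> crossing u r s) ->
  labels step_plus (powop a u) p q -> crossing (powop a u) p q.
Proof.
move=> Ea Cu; have [f fc aE] := bar_coherent sigE Ea; rewrite {}aE in Ea *.
(* The first summand makes [f m] a valid index in the relation semigroup; the second makes the walk
   long enough for a cycle with steps left after it. *)
pose N := #|state B|; pose m := fsg_card (relsem (state B)) + N.+2.
move=> pq.
have {pq}/vpow_walk[s [s0 s_last s_step]] : labels step_plus (vpow u (f m)) p q.
  by rewrite /labels /vpow (spow_coherent _ fc) ?leq_addr.
(* States are compared from [s 1] on, so that the part before the cycle is a nonempty power. *)
have /injectivePn[i [j neq_ij eq_ij]] :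
    ~~ injectiveb (fun i : 'I_N.+1 => s i.+1).
  by apply/injectiveP => /leq_card; rewrite card_ord /N ltnn.
wlog lt_ij : i j neq_ij eq_ij / i < j.
  move=> W; case: (ltngtP i j) => [ij|ji|/val_inj ij]; first exact: W ij.
    by apply: (W j i) => //; rewrite eq_sym.
  by rewrite ij eqxx in neq_ij.
have le_Nm : N.+2 <= m := leq_addl _ _.
have lt_j := ltn_ord j; have le_m := coherent_ge m fc.
have le_c : 0 < j - i <= m by lia.
(* Of the k steps outside the cycle, i + 1 come before it and l + 1 after it. *)
pose k := (f m).+1 - (j - i); pose l := k - i.+2.
have le_k : j.+2 <= (f m).+1 by lia.
have kE : k + (j - i) = (f m).+1 by rewrite /k; lia.
have [g [gc Eg gE]] := bar_div pureE fc Ea le_c kE.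
(* In each finite semigroup of size n both sides are powers of the value of [u], with indices at
   least n and congruent modulo n! by [gE]. *)
have -> : powop (seqop f) u =
    mulop (mulop (vpow u i) (powop (seqop g) (vpow u (j - i).-1))) (vpow u l).
  apply: rawop_ext => S phi.
  rewrite /mulop /powop /vpow /seqop spow_spow !spowD prednK; last by lia.
  set n := fsg_card S; have ge_f := coherent_ge n fc; have ge_g := coherent_ge n gc.
  set e := _.+1.
  have eE : e.+1 = (j - i) * (g n).+1 + k.
    rewrite /e /l /k; case: (j - i) le_c kE => [//|c] _ kE /=; nia.
  apply: spow_period => //.
    by have : n <= e by rewrite -ltnS eE; nia.
  by apply/eqP; rewrite -(eqn_modDr 1) !addn1 eE gE.
have Cs t : t <= f m -> crossing u (s t) (s t.+1) by move/s_step/Cu.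
apply: (@crossing_mul _ _ _ (s j.+1)).
  apply: (@crossing_mul _ _ _ (s i.+1)).
    by rewrite -s0; apply: crossing_vpow => t le_t; apply: Cs; lia.
  rewrite -eq_ij; apply: crossing_pow => //.
  have := @crossing_vpow u (fun t => s (i.+1 + t)) (j - i).-1.
  rewrite addn0 prednK ?subn_gt0 // (_ : i.+1 + (j - i) = j.+1); last by lia.
  rewrite -eq_ij; apply=> t le_t; rewrite addnS; apply: Cs; lia.
have := @crossing_vpow u (fun t => s (j.+1 + t)) l.
rewrite addn0 (_ : j.+1 + l.+1 = (f m).+1); last by rewrite /l; lia.
rewrite s_last; apply=> t le_t; rewrite addnS; apply: Cs; rewrite /l in le_t; lia.
Qed.

Lemma omega_crossing u p q :
  omega_sigma E u -> labels step_plus u p q -> crossing u p q.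
Proof.
move=> os_u; elim: os_u p q => {u} [x|u v _ Cu _ Cv|a u Ea _ Cu] p q.
- by rewrite labels_letter; apply: crossing_letter.
- by case/labels_mul=> r /Cu pr /Cv; apply: crossing_mul pr.
exact/crossing_powop/Cu/bar_base.
Qed.

(** Testing against the relation semigroup of [nfa_plus B] gives a word of L^+ with the same labels
    as [u]. So [u] labels an accepting path, and the final state completes the last factor of its
    crossing. *)
Lemma closure_plus_gen u :
  closure (plus_of L) u -> gen_sub E (closure L) u.
Proof.
move=> [os_u cl_u].
have [a [[x [t [Lxt aE]]] a_u]] := cl_u
  [:: existT (fun S => X -> elt S) (relsem (state B))
     (fun x => enum_rank [set pq | step_plus x pq.1 pq.2])].
have [i [f [/= ini fin wif]]] := ((recognizes_plus BL).2 _).1 Lxt.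
have u_if : labels step_plus u i f.
  have /labels_word : path_rel step_plus i (x :: t) f := wif.
  by rewrite -aE /labels; have /= -> := a_u _ (or_introl erefl).
case: (omega_crossing os_u u_if) => [u_if1|[_ Tu]|[b [d [g [-> fing b_ig Td]]]]].
- exact/gs_base/(arrow_closure ini fin).
- exact: tail_final Tu.
apply: gs_mul (tail_final fin Td).
exact/gs_base/(arrow_closure ini fing).
Qed.

End PlusClosure.

Theorem theorem3p5 (X : finType) (E : NHat -> Prop) (L : seq X -> Prop) :
  unary_signature E -> contains_kappa E -> pure E -> rational L ->
  forall u : rawop X,
    closure_in E (lang_image (plus_of L)) u <->
    gen_sub E (closure_in E (lang_image L)) u.
Proof.
move=> sigE kappaE pureE /rational_recognizes[B BL] u; split.
  exact: (closure_plus_gen sigE kappaE BL pureE).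
exact: gen_closure_plus.
Qed.
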